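(* Let $n,k$ be positive integers and let $X=\{x_1,\ldots,x_n\}\subset\mathbb{R}$ be a set of $n$ real numbers (indexed, possibly with repeated values) whose sum is zero, with $x_i\ge x_j$ whenever $i\le j$. If $n\ge 8k^2$, then at least $\binom{n-1}{k-1}$ $k$-element subsets of $X$ have nonnegative sum. Moreover, if equality holds (i.e. exactly $\binom{n-1}{k-1}$ $k$-element subsets of $X$ have nonnegative sum), then the family of $k$-element subsets of $X$ with nonnegative sum is the star on $x_1$, namely $\left\{S\in\binom{X}{k} : x_1\in S\right\}$.
   Context: The numbers $x_1,\ldots,x_n$ are regarded as $n$ distinct labelled elements, even if some values coincide; thus $k$-element subsets of $X$ correspond to $k$-element subsets of the index set $\{1,\ldots,n\}$, and the sum of a subset is the sum of the corresponding $x_i$. $\binom{X}{k}$ denotes the family of all $k$-element subsets of $X$; ''$x_1\in S$'' means that the index $1$ belongs to the index set of $S$. *)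

(* Defs.v *)
From mathcomp Require Import all_boot all_order all_algebra.
From mathcomp Require Import reals.

Set Implicit Arguments.
Unset Strict Implicit.
Unset Printing Implicit Defensive.

Import Order.TTheory GRing.Theory Num.Theory.
Local Open Scope ring_scope.

(* The labelled numbers x_1, ..., x_n are a function x : 'I_n -> R, with x_i
   stored at index i - 1; subsets of X are sets of indices, so that repeated
   values remain distinct elements. *)

Definition ksubsets (n k : nat) : {set {set 'I_n}} :=
  [set S : {set 'I_n} | #|S| == k].

Definition nonneg_ksubsets (R : realType) (n k : nat) (x : 'I_n -> R) :
    {set {set 'I_n}} :=
  [set S in ksubsets n k | 0 <= \sum_(i in S) x i].

Definition star (n k : nat) (i : 'I_n) : {set {set 'I_n}} :=
  [set S in ksubsets n k | i \in S].

(* Main.v *)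
(* Let x_1 be maximal and D the set of negative k-sets containing 1, of size d.
   If D is empty, the star on x_1 consists of nonnegative sets. Otherwise fix A
   in D: its complement has nonnegative sum, hence so has some subset of it whose
   size is the largest multiple of k below n - k, and there disjointness double
   counting yields p >= C(n-2k, k-1) >= C(n-1, k-1) / 2 nonnegative k-sets
   avoiding 1, for a total of at least C(n-1, k-1) - d + p. This is enough if
   d < p; if d >= p, the d negative sets must be compensated by the nonnegative
   ones, which gives k^2 N >= d (n - k), hence N >= 7 d > C(n-1, k-1). *)
Require Import Defs.
From mathcomp Require Import all_boot all_order all_algebra.
From mathcomp Require Import reals.
From mathcomp Require Import zify.

Set Implicit Arguments.
Unset Strict Implicit.
Unset Printing Implicit Defensive.

Import Order.TTheory GRing.Theory Num.Theory.
Local Open Scope ring_scope.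

(** * Counting sets through a point, a binomial estimate, incidences *)

Lemma card_draws_mem (T : finType) (B : {set T}) (y : T) (k : nat) :
  y \in B -> (0 < k)%N ->
  #|[set A : {set T} | [&& A \subset B, #|A| == k & y \in A]]| =
  'C(#|B|.-1, k.-1).
Proof.
move=> yB; case: k => // k _.
have := cardsID [set A : {set T} | y \in A]
  [set A : {set T} | A \subset B & #|A| == k.+1].
rewrite cards_draws (cardsD1 y B) yB add1n binS addnC /=.
have <- : [set A : {set T} | A \subset B :\ y & #|A| == k.+1] =
    [set A : {set T} | A \subset B & #|A| == k.+1] :\: [set A : {set T} | y \in A].
  by apply/setP=> A; rewrite !inE subsetD1 andbAC andbC.
rewrite cards_draws => /addnI <-.
by apply: eq_card => A; rewrite !inE andbA.
Qed.

(** Iterating Pascal's rule, each of the [s] steps adds at most ['C(m + s - 1, j - 1)], which is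
    ['C(m + s, j)] times [j / (m + s)]. *)
Lemma leq_bin_addl (m s j : nat) :
  ((m + s) * 'C(m + s, j) <= (m + s) * 'C(m, j) + s * j * 'C(m + s, j))%N.
Proof.
case: j => [|j]; first by rewrite !bin0 leq_addr.
case: s => [|s]; first by rewrite !mul0n !addn0.
rewrite -[X in (_ <= _ + X)%N]mulnA -mul_bin_diag mulnCA -mulnDr leq_mul2l.
apply/orP; right; rewrite addnS /=.
elim: s => [|s IHs]; first by rewrite addn0 mul1n binS.
rewrite addnS binS mulSn addnCA addnC leq_add2l (leq_trans IHs) //.
by rewrite leq_add2l leq_mul2l leq_bin2l ?orbT.
Qed.

Lemma leq_double_count (T U : finType) (r : T -> U -> bool) (P : {set T})
    (Q : {set U}) (a b : nat) :
  (forall p, p \in P -> (a <= #|[set q in Q | r p q]|)%N) ->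
  (forall q, q \in Q -> (#|[set p in P | r p q]| <= b)%N) ->
  (#|P| * a <= #|Q| * b)%N.
Proof.
move=> leP leQ; rewrite -!sum_nat_const.
apply: (@leq_trans (\sum_(p in P) \sum_(q in Q | r p q) 1)%N).
  apply: leq_sum => p pP; apply: leq_trans (leP p pP) _.
  by rewrite sum1_card; apply/eq_leq/eq_card => q; rewrite !inE.
rewrite (exchange_big_dep (mem Q)) //= => [|p q _ /andP[]//].
apply: leq_sum => q qQ; apply: leq_trans (leQ q qQ).
by rewrite sum1_card; apply/eq_leq/eq_card => p; rewrite !inE qQ.
Qed.

(** * Weighted finite sets and their nonnegative subsets *)

Section Nonneg.

Variables (R : realDomainType) (T : finType) (x : T -> R).

Definition nonneg_draws (B : {set T}) (k : nat) : {set {set T}} :=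
  [set S : {set T} | [&& S \subset B, #|S| == k & 0 <= \sum_(i in S) x i]].

Definition neg_star (m : T) (k : nat) : {set {set T}} :=
  [set A : {set T} | [&& #|A| == k, m \in A & \sum_(i in A) x i < 0]].

(** Delete minimal elements one by one: a negative minimum raises the sum when removed, a
    nonnegative one leaves only nonnegative terms. *)
Lemma nonneg_subset (B : {set T}) (m : nat) :
  (m <= #|B|)%N -> 0 <= \sum_(i in B) x i ->
  exists C : {set T}, [/\ C \subset B, #|C| = m & 0 <= \sum_(i in C) x i].
Proof.
elim: {B}_.+1 {-2}B (ltnSn #|B|) => // n IHn B; rewrite ltnS => leBn leqmB sumB.
have [->|neqmB] := eqVneq m #|B|; first by exists B.
have /card_gt0P[y0 y0B] : (0 < #|B|)%N by lia.
case: (arg_minP (P := fun i => i \in B) x y0B) => y yB miny.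
have sumBy : 0 <= \sum_(i in B :\ y) x i.
  have [xy_ge0|xy_lt0] := leP 0 (x y).
    by apply: sumr_ge0 => i /setD1P[_ /miny]; apply: le_trans.
  apply: le_trans sumB _; rewrite (big_setD1 y) //=.
  by rewrite gerDr ltW.
have := cardsD1 y B; rewrite yB => cardB.
case: (IHn (B :\ y) _ _ sumBy) => [||C [CB cardC sumC]]; [lia|lia|].
by exists C; split=> //; apply: subset_trans CB (subD1set _ _).
Qed.

(* For a fixed [y] in [B], counting disjoint pairs shows that there are at least
   as many nonnegative sets avoiding [y] as negative sets containing [y]: by
   induction the complement of a negative set contains at least as many
   nonnegative [k]-sets as there are [k]-sets through [y] off a given [k]-set. *)
Lemma nonneg_draws_divisible (B : {set T}) (q k : nat) :
  (0 < k)%N -> #|B| = (q.+1 * k)%N -> 0 <= \sum_(i in B) x i ->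
  ('C(#|B|.-1, k.-1) <= #|nonneg_draws B k|)%N.
Proof.
move=> k_gt0; elim: q B => [|q IHq] B cardB sumB.
  rewrite cardB mul1n binn; apply/card_gt0P; exists B.
  by rewrite inE subxx cardB mul1n eqxx.
have /card_gt0P[y yB] : (0 < #|B|)%N by rewrite cardB mulSn; lia.
pose D := [set A : {set T} |
  [&& A \subset B, #|A| == k, y \in A & \sum_(i in A) x i < 0]].
pose P := [set S in nonneg_draws B k | y \notin S].
(* In the disjointness graph, [c] bounds degrees from below on [D] and from above on [P], so it
   cancels. *)
pose c := 'C((q.+1 * k).-1, k.-1).
have c_gt0 : (0 < c)%N by rewrite bin_gt0 mulSn; lia.
have leDP : (#|D| <= #|P|)%N.
  rewrite -(leq_pmul2r c_gt0).
  apply: (leq_double_count (r := fun A S : {set T} => [disjoint A & S])).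
    move=> A; rewrite inE => /and4P[AB /eqP cardA yA sumA].
    have cardBA : #|B :\: A| = (q.+1 * k)%N.
      have := cardsID A B; rewrite (setIidPr AB) cardA cardB => /eqP.
      by rewrite mulSn eqn_add2l => /eqP.
    have sumBA : 0 <= \sum_(i in B :\: A) x i.
      move: sumB; rewrite (big_setID A) (setIidPr AB) /= => sumB.
      by rewrite -(lerD2l (\sum_(i in A) x i)) addr0; apply: le_trans sumB; apply: ltW.
    have := IHq _ cardBA sumBA; rewrite cardBA => /leq_trans; apply.
    apply/subset_leq_card/subsetP => S; rewrite !inE subsetD.
    move=> /and3P[/andP[-> disSA] -> ->]; rewrite disjoint_sym disSA /= andbT.
    by apply: contraL disSA => yS; apply/pred0Pn; exists y; rewrite /= yS yA.
  move=> S; rewrite !inE => /andP[/and3P[SB /eqP cardS _] yS].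
  have cardBS : #|B :\: S| = (q.+1 * k)%N.
    have := cardsID S B; rewrite (setIidPr SB) cardS cardB => /eqP.
    by rewrite mulSn eqn_add2l => /eqP.
  rewrite /c -cardBS -(card_draws_mem (y := y)) ?inE ?yS //.
  apply/subset_leq_card/subsetP => A; rewrite !inE subsetD.
  by move=> /andP[/and4P[-> -> -> _] ->].
rewrite -(card_draws_mem yB k_gt0).
rewrite -(cardsID [set S : {set T} | y \notin S] (nonneg_draws B k)).
rewrite -(cardsID [set S : {set T} | \sum_(i in S) x i < 0]).
apply: leq_add.
  apply: leq_trans (leq_trans leDP _); apply/subset_leq_card/subsetP => S.
    by rewrite !inE => /andP[/and3P[-> -> ->] ->].
  by rewrite !inE => /andP[-> ->].
apply/subset_leq_card/subsetP => S; rewrite !inE -leNgt negbK.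
by move=> /andP[-> /and3P[-> -> ->]].
Qed.

Lemma sum_setC (A : {set T}) : \sum_i x i = 0 ->
  \sum_(i in ~: A) x i = - \sum_(i in A) x i.
Proof.
rewrite (bigID (mem A)) /= addrC => /eqP; rewrite addr_eq0 => /eqP <-.
by apply: eq_bigl => i; rewrite inE.
Qed.

Lemma sum_draws_eq0 (k : nat) : (0 < k)%N -> \sum_i x i = 0 ->
  \sum_(S : {set T} | #|S| == k) \sum_(i in S) x i = 0.
Proof.
move=> k_gt0 sumx; rewrite (exchange_big_dep predT) //=.
transitivity (\sum_i x i *+ 'C(#|T|.-1, k.-1)).
  apply: eq_bigr => i _; rewrite sumr_const -cardsT.
  rewrite -(card_draws_mem (in_setT i) k_gt0); congr (_ *+ _).
  by apply: eq_card => S; rewrite !inE subsetT.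
by rewrite sumrMnl sumx mul0rn.
Qed.

(* Exchanging the maximal element [m] of a negative set for some [y] outside it
   lowers the sum by [x m - x y], which averages to about [x m]; since all the
   [k]-sets sum to zero, these deficits are paid for by the nonnegative sets, and
   each of them has sum at most [k * x m]. *)
Lemma leq_neg_star (m : T) (k : nat) : (0 < k)%N -> \sum_i x i = 0 ->
  (forall i, x i <= x m) ->
  (#|neg_star m k| * (#|T| - k) <= k ^ 2 * #|nonneg_draws setT k|)%N.
Proof.
move=> k_gt0 sumx maxm; set D := neg_star m k; set N := nonneg_draws _ _.
pose s (S : {set T}) := \sum_(i in S) x i.
have [->|[A0 A0D]] := set_0Vmem D; first by rewrite cards0.
have [leTk|ltkT] := leqP #|T| k.
  by move: leTk; rewrite -subn_eq0 => /eqP->; rewrite muln0.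
have xm_gt0 : 0 < x m.
  rewrite ltNge; apply: contraL A0D => xm_le0; rewrite inE !negb_and -leNgt.
  rewrite -oppr_le0 -sum_setC //; apply/orP; right; apply/orP; right.
  by apply: sumr_le0 => i _; apply: le_trans (maxm i) xm_le0.
pose g S := Num.max 0 (- s S).
have g_ge0 S : 0 <= g S by rewrite le_max lexx.
have lower : (#|D| * (#|T| - k))%:R * x m <=
    \sum_(A in D) \sum_(y in ~: A) g (y |: (A :\ m)).
  rewrite natrM -mulrA mulr_natl -sumr_const; apply: ler_sum => A.
  rewrite inE => /and3P[/eqP cardA mA sA]; have cardCA := cardsC A.
  (* With [r = #|~: A| > 0], this sum is [r * x m - (r - 1) * s A], and [s A < 0]. *)
  apply: (@le_trans _ _ (\sum_(y in ~: A) (x m - s A - x y))).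
    rewrite big_split /= sumrN sum_setC // -/(s _) sumr_const opprK.
    rewrite -cardCA cardA addKn mulr_natl mulrnBl -addrA lerDl.
    have -> : #|~: A| = (#|~: A|.-1).+1 by lia.
    by rewrite mulrSr opprD subrK oppr_ge0 mulrn_wle0 ?ltW.
  apply: ler_sum => y; rewrite inE => yA.
  rewrite /g le_max; apply/orP; right; rewrite /s big_setU1 /=; last first.
    by rewrite in_setD1 (negPf yA) andbF.
  by rewrite [\sum_(i in A) _](big_setD1 m) //= opprD addrA subrr add0r -opprD addrC.
have upper : \sum_(A in D) \sum_(y in ~: A) g (y |: (A :\ m)) <=
    \sum_(S : {set T} | #|S| == k) g S *+ k.
  rewrite (exchange_big_dep predT) //=.
  apply: (@le_trans _ _ (\sum_y \sum_(S : {set T} | (#|S| == k) && (y \in S)) g S)).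
    apply: ler_sum => y _.
    (* Undoing the exchange: [y] and the new set determine [A], so a [k]-set arises at most once for
       each of its [k] elements [y]. *)
    pose f (S : {set T}) := m |: (S :\ y).
    pose h (A : {set T}) := y |: (A :\ m).
    rewrite (reindex_onto f h) /=; last first.
      move=> A; rewrite !inE => /andP[/and3P[_ mA _] yA].
      by rewrite /f /h setU1K ?setD1K // in_setD1 (negPf yA) andbF.
    rewrite [leLHS]big_mkcond [leRHS]big_mkcond /=; apply: ler_sum => S _.
    case: ifPn => [/andP[/andP[]]|_]; last by case: ifP.
    rewrite in_setC [f S \in _]inE => /and3P[/eqP cardf _ _] yf /eqP hfS.
    have yS : y \in S by rewrite -hfS /h setU11.
    have mS : m \notin S.
      have ym : y != m by apply: contraNneq yf => ->; rewrite /f setU11.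
      by rewrite -hfS /h !inE eqxx eq_sym (negPf ym).
    have /eqP : #|S| = k.
      by rewrite -cardf /f cardsU1 (cardsD1 y S) yS !inE (negPf mS) andbF.
    by move=> ->; rewrite yS /= -[leRHS]/(g S) -{2}hfS.
  rewrite (exchange_big_dep (fun S : {set T} => #|S| == k)) /=; last by move=> ? ? _ /andP[].
  apply: ler_sum => S /eqP cardS; rewrite -cardS -sumr_const.
  by rewrite (eq_bigl (fun y => y \in S)) // => y; rewrite eqxx.
(* Adding [s S], whose total is zero, turns negative parts into positive parts, which live on
   [N]. *)
have paid : \sum_(S : {set T} | #|S| == k) g S <= x m *+ (#|N| * k).
  have -> : \sum_(S : {set T} | #|S| == k) g S = \sum_(S : {set T} | #|S| == k) (g S + s S).
    by rewrite big_split /= sum_draws_eq0 ?addr0.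
  rewrite [(#|N| * k)%N]mulnC mulrnA -sumr_const big_mkcond [leRHS]big_mkcond /=.
  apply: ler_sum => S _; rewrite inE subsetT /= -/(s S).
  case: eqP => [cardS|_] //=; rewrite /g.
  have [sS|sS] := leP 0 (s S); last by rewrite max_r ?oppr_ge0 ?(ltW sS) ?addNr.
  rewrite max_l ?oppr_le0 // add0r -cardS -sumr_const.
  by apply: ler_sum => i _.
have := le_trans lower upper; rewrite sumrMnl => le1.
have : (#|D| * (#|T| - k))%:R * x m <= (#|N| * k * k)%:R * x m.
  by apply: le_trans le1 _; rewrite mulr_natl mulrnA lerMn2r paid orbT.
by rewrite ler_pM2r // ler_nat -mulnA mulnn [(#|N| * _)%N]mulnC.
Qed.

End Nonneg.

Theorem theorem1p2 (R : realType) (n k : nat) (n_gt0 : (0 < n)%N)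
    (k_gt0 : (0 < k)%N) (x : 'I_n -> R)
    (sum_x : \sum_(i < n) x i = 0)
    (x_sorted : forall i j : 'I_n, (i <= j)%N -> x j <= x i)
    (n_large : (8 * k ^ 2 <= n)%N) :
  ('C(n.-1, k.-1) <= #|nonneg_ksubsets k x|)%N /\
  (#|nonneg_ksubsets k x| = 'C(n.-1, k.-1) ->
   nonneg_ksubsets k x = star k (Ordinal n_gt0)).
Proof.
set m := Ordinal n_gt0; have maxm i : x i <= x m by apply: x_sorted.
set N := nonneg_ksubsets k x; set C := 'C(n.-1, k.-1).
have card_star : #|star k m| = C.
  have := card_draws_mem (in_setT m) k_gt0; rewrite cardsT card_ord -/C => <-.
  by apply: eq_card => S; rewrite !inE subsetT.
have [D0|[A AD]] := set_0Vmem (neg_star x m k).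
  have starN : star k m \subset N.
    apply/subsetP => S; rewrite !inE => /andP[cardS mS]; rewrite cardS leNgt /=.
    by apply: contra_eqN D0 => sS; apply/set0Pn; exists S; rewrite inE cardS mS.
  split=> [|cardN]; first by rewrite -card_star subset_leq_card.
  by apply/esym/eqP; rewrite eqEcard starN cardN card_star /=.
(* A negative set through [m] forces strict inequality, so the equality case is vacuous. *)
suff ltCN : (C < #|N|)%N by split=> [|cardN]; [exact: ltnW | rewrite cardN ltnn in ltCN].
have leDN : (#|neg_star x m k| * (n - k) <= k ^ 2 * #|N|)%N.
  have := leq_neg_star k_gt0 sum_x maxm; rewrite card_ord => /leq_trans; apply.
  by rewrite leq_mul2l; apply/orP; right; apply/eq_leq/eq_card => S; rewrite !inE subsetT.
pose P := [set S in N | m \notin S].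
have cardN : (#|N| + #|neg_star x m k| = C + #|P|)%N.
  pose avoid := [set S : {set 'I_n} | m \notin S].
  pose neg := [set S : {set 'I_n} | \sum_(i in S) x i < 0].
  rewrite -card_star -(cardsID avoid N) -(cardsID neg (star k m)).
  have -> : N :&: avoid = P by apply/setP=> S; rewrite !inE.
  have -> : N :\: avoid = star k m :\: neg.
    by apply/setP=> S; rewrite !inE negbK -leNgt andbA andbC [(m \in S) && _]andbC.
  have -> : neg_star x m k = star k m :&: neg by apply/setP=> S; rewrite !inE andbA.
  by rewrite addnC [(#|P| + _)%N]addnC addnA.
have leCP : (C <= 2 * #|P|)%N.
  move: AD; rewrite inE => /and3P[/eqP cardA mA sumA].
  have cardCA := cardsC A; rewrite cardA card_ord in cardCA.
  have sumCA : 0 <= \sum_(i in ~: A) x i by rewrite sum_setC // oppr_ge0 ltW.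
  have divCA := divn_eq #|~: A| k; have modCA := ltn_pmod #|~: A| k_gt0.
  have lekn : (k <= k ^ 2)%N by rewrite expnS expn1 leq_pmulr.
  have q_gt0 : (0 < #|~: A| %/ k)%N by rewrite divn_gt0 //; lia.
  have [B [BA cardB sumB]] := nonneg_subset (leq_trunc_div _ _ : _ %/ k * k <= _)%N sumCA.
  (* Rounding down to a multiple of [k] loses at most [k - 1] elements, so [#|B| - 1] is at least
     [n - 2k]. *)
  have leP : ('C(n - k.*2, k.-1) <= #|P|)%N.
    apply: leq_trans (leq_bin2l _ _) (leq_trans (nonneg_draws_divisible k_gt0 _ sumB) _).
    - by rewrite cardB; lia.
    - by rewrite cardB -[in LHS](prednK q_gt0).
    apply/subset_leq_card/subsetP => S; rewrite !inE => /and3P[SB -> ->] /=.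
    by apply: contraL mA => mS; have := subsetP (subset_trans SB BA) _ mS; rewrite inE.
  have := leq_bin_addl (n - k.*2) (k.*2).-1 k.-1.
  have -> : (n - k.*2 + (k.*2).-1 = n.-1)%N by lia.
  rewrite -/C => leC.
  (* Passing from [n - 1] to [n - 2k] thus loses at most half of [C]. *)
  have small : (2 * ((k.*2).-1 * k.-1) <= n.-1)%N by nia.
  rewrite -(@leq_pmul2l n.-1); last by lia.
  have : (2 * ((k.*2).-1 * k.-1 * C) <= n.-1 * C)%N by rewrite mulnA leq_mul2r small orbT.
  have : (n.-1 * 'C(n - k.*2, k.-1) <= n.-1 * #|P|)%N by rewrite leq_mul2l leP orbT.
  lia.
have d_gt0 : (0 < #|neg_star x m k|)%N by apply/card_gt0P; exists A.
(* The factor 7 comes from [n - k >= 8 k^2 - k >= 7 k^2]. *)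
have le7 : (7 * #|neg_star x m k| <= #|N|)%N.
  rewrite -(@leq_pmul2l (k ^ 2)) ?expn_gt0 ?k_gt0 //; apply: leq_trans leDN.
  rewrite mulnA mulnC leq_mul2l; apply/orP; right.
  have : (k <= k ^ 2)%N by rewrite expnS expn1 leq_pmulr.
  lia.
(* If [#|N| <= C], then [#|P| <= d] for [d] the size of [neg_star x m k], so
   [7 d <= #|N| <= C <= 2 d], contradicting [d > 0]. *)
lia.
Qed.
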